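(* Let $\alpha,a\in\mathbb{R}$. For every integer $\nu\ge 0$ and all $x\in\mathbb{R}$, with $\lambda_\nu=\nu(2a+\nu+1)$, $$\sigma(x)\frac{d^2 Q^{(\alpha,-a)}_\nu(x)}{dx^2}+[\alpha-\sigma'(x)(a+\nu)]\frac{d Q^{(\alpha,-a)}_\nu(x)}{dx}=-\lambda_\nu Q^{(\alpha,-a)}_\nu(x).$$
   Context: Throughout $x$ is a real variable, $\alpha,a$ are real parameters, $\sigma(x)=1+x^2$, and $\cot^{-1}:\mathbb{R}\to(0,\pi)$ is the smooth branch, so that $\frac{d}{dx}\cot^{-1}x=-1/\sigma(x)$. For integers $l\ge 0$ put $w_l(x)=\sigma(x)^{-(l+a+1)}e^{-\alpha\cot^{-1}x}=\sigma(x)^{-l}w_0(x)$. Define $P_l^{(a,\alpha)}(x)=\frac{1}{w_l(x)}\frac{d^l}{dx^l}[w_l(x)\sigma(x)^l]=\frac{\sigma(x)^l}{w_0(x)}\frac{d^l w_0(x)}{dx^l}$. The complementary (Romanovski) polynomials $Q_\nu^{(\alpha,-a)}$, with $Q_0^{(\alpha,-a)}\equiv 1$, are defined by the Rodrigues representation $P_l^{(a,\alpha)}(x)=\frac{1}{w_l(x)}\frac{d^{l-\nu}}{dx^{l-\nu}}[\sigma(x)^{l-\nu}w_l(x)Q_\nu^{(\alpha,-a)}(x)]$ for all integers $0\le\nu\le l$ (the case $l=\nu$ reads $Q_\nu^{(\alpha,-a)}=P_\nu^{(a,\alpha)}$). The second upper index is minus the parameter $a$ of the weight. *)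

(* Defs.v *)
From Stdlib Require Import Reals Lra Lia Arith.
From Coquelicot Require Import Coquelicot.
Open Scope R_scope.

Definition rom_sigma (x : R) : R := 1 + x ^ 2.

(* The smooth branch of the inverse cotangent, with values in (0, PI); see
   [rom_acot_bound], [cot_rom_acot] and [is_derive_rom_acot]. *)
Definition rom_acot (x : R) : R := PI / 2 - atan x.

Definition rom_w (a alpha : R) (l : nat) (x : R) : R :=
  Rpower (rom_sigma x) (- (INR l + a + 1)) * exp (- alpha * rom_acot x).

Definition rom_P (a alpha : R) (l : nat) (x : R) : R :=
  / rom_w a alpha l x * Derive_n (fun t => rom_w a alpha l t * rom_sigma t ^ l) l x.

(* [Q nu] is Q_nu^(alpha,-a): the second upper index is minus the parameter [a]
   of the weight.  For [l = nu] the [0]-th derivative is the function itself, so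
   the clause reads [Q nu = rom_P a alpha nu]; hence such a [Q] is unique, and it
   exists ([rom_complementary_unique], [rom_complementary_exists]). *)
Definition rom_complementary (alpha a : R) (Q : nat -> R -> R) : Prop :=
  (forall x : R, Q 0%nat x = 1) /\
  (forall l nu : nat, (nu <= l)%nat -> forall x : R,
     rom_P a alpha l x =
     / rom_w a alpha l x *
     Derive_n (fun t => rom_sigma t ^ (l - nu) * rom_w a alpha l t * Q nu t)
              (l - nu) x).

Lemma rom_acot_bound (x : R) : 0 < rom_acot x < PI.
Proof. unfold rom_acot; pose proof (atan_bound x); lra. Qed.

Lemma cot_rom_acot (x : R) : cos (rom_acot x) / sin (rom_acot x) = x.
Proof.
  unfold rom_acot; rewrite cos_shift, sin_shift.
  change (tan (atan x) = x); apply tan_atan.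
Qed.

Lemma rom_sigma_pos (x : R) : 0 < rom_sigma x.
Proof. unfold rom_sigma; nra. Qed.

Lemma is_derive_rom_acot (x : R) : is_derive rom_acot x (- 1 / rom_sigma x).
Proof.
  unfold rom_acot, rom_sigma; pose proof (rom_sigma_pos x) as H; unfold rom_sigma in H.
  auto_derive; [exact I|].
  unfold Rsqr; field; simpl in *; lra.
Qed.

Lemma rom_w_pos (a alpha : R) (l : nat) (x : R) : 0 < rom_w a alpha l x.
Proof.
  unfold rom_w; apply Rmult_lt_0_compat; [unfold Rpower|]; apply exp_pos.
Qed.

Lemma rom_w_sigma (a alpha : R) (l : nat) (x : R) :
  rom_w a alpha l x * rom_sigma x ^ l = rom_w a alpha 0 x.
Proof.
  unfold rom_w.
  rewrite <- (Rpower_pow l (rom_sigma x)) by apply rom_sigma_pos.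
  rewrite (Rmult_comm (Rpower _ _)), Rmult_assoc, <- Rpower_plus, Rmult_comm.
  do 2 f_equal; simpl; ring.
Qed.

Lemma rom_PE (a alpha : R) (l : nat) (x : R) :
  rom_P a alpha l x = rom_sigma x ^ l / rom_w a alpha 0 x * Derive_n (rom_w a alpha 0) l x.
Proof.
  unfold rom_P.
  rewrite (Derive_n_ext _ (rom_w a alpha 0)) by (intro; apply rom_w_sigma).
  rewrite <- (rom_w_sigma a alpha l x).
  pose proof (rom_w_pos a alpha l x).
  pose proof (pow_lt _ l (rom_sigma_pos x)).
  field; lra.
Qed.

Lemma rom_complementary_unique (alpha a : R) (Q : nat -> R -> R) :
  rom_complementary alpha a Q -> forall nu x, Q nu x = rom_P a alpha nu x.
Proof.
  intros [_ H] nu x; rewrite (H nu nu (Nat.le_refl nu)), Nat.sub_diag; simpl.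
  pose proof (rom_w_pos a alpha nu x); field; lra.
Qed.

Lemma rom_complementary_exists (alpha a : R) : rom_complementary alpha a (rom_P a alpha).
Proof.
  split.
  - intro x; rewrite rom_PE; simpl; pose proof (rom_w_pos a alpha 0 x); field; lra.
  - intros l nu Hl x; unfold rom_P at 1; f_equal.
    rewrite (Derive_n_ext _ (rom_w a alpha 0)) by (intro; apply rom_w_sigma).
    transitivity (Derive_n (Derive_n (rom_w a alpha 0) nu) (l - nu) x).
    + rewrite Derive_n_comp, Nat.sub_add by exact Hl; reflexivity.
    + apply Derive_n_ext; intro t; symmetry; rewrite rom_PE, <- (rom_w_sigma a alpha l t).
      replace (rom_sigma t ^ l) with (rom_sigma t ^ (l - nu) * rom_sigma t ^ nu)
        by (rewrite <- pow_add; f_equal; lia).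
      pose proof (rom_w_pos a alpha l t).
      pose proof (pow_lt _ nu (rom_sigma_pos t)).
      pose proof (pow_lt _ (l - nu) (rom_sigma_pos t)).
      field; repeat split; lra.
Qed.

(* Main.v *)
Require Import Defs.
From Stdlib Require Import Reals Lra.
From Coquelicot Require Import Coquelicot.
Open Scope R_scope.

(** The weight [w = w_0] satisfies Pearson's equation [sigma w' = tau w] with
    [tau x = alpha - 2 (a + 1) x] ([is_derive_rom_w]).  Since [sigma] is quadratic
    and [tau] affine, Leibniz' rule applied to this equation yields a three-term
    recurrence for the functions [Q_n = sigma ^ n w^(n) / w]:
    [Q_(n+1) = (tau - 2 n x) Q_n - lambda_n sigma Q_(n-1)],
    where [lambda_n = n (2 a + n + 1)].

    The proof goes in the opposite direction, which dispenses with the iterated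
    Leibniz rule: the recurrence defines polynomials [rom_rec], for which induction
    gives the lowering relation [Q_n' = - lambda_n Q_(n-1)] ([is_derive_rom_rec]).
    Put into the recurrence, it becomes the raising relation
    [Q_(n+1) = sigma Q_n' + (tau - 2 n x) Q_n], which together with Pearson's
    equation says that differentiating [w Q_n / sigma ^ n] gives
    [w Q_(n+1) / sigma ^ (n + 1)].  Hence [w^(n) = w Q_n / sigma ^ n]
    ([Derive_n_rom_w]), and [rom_rec] is the complementary family.

    The differential equation for [Q_n] is the composite of the two relations.
    Differentiating the raising relation and lowering [Q_(n+1)'] back to
    [- lambda_(n+1) Q_n] gives
    [sigma Q_n'' + (tau + 2 (1 - n) x) Q_n' = (2 (a + 1 + n) - lambda_(n+1)) Q_n],
    and the factor on the right is [- lambda_n].  For [n >= 1] the same computation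
    is carried out below one step lower, on [Q_n'' = lambda_n lambda_(n-1) Q_(n-2)],
    where the equation reduces to the recurrence itself. *)

Definition rom_lambda (a : R) (n : nat) : R := INR n * (2 * a + INR n + 1).

(** For [n = 0] the index [pred n] is a junk value, multiplied by [rom_lambda a 0 = 0]. *)
Fixpoint rom_rec (alpha a : R) (n : nat) (x : R) : R :=
  match n with
  | O => 1
  | S m => (alpha - 2 * (a + 1) * x - 2 * INR m * x) * rom_rec alpha a m x
           - rom_lambda a m * rom_sigma x * rom_rec alpha a (pred m) x
  end.

Lemma rom_recS (alpha a : R) (n : nat) (x : R) :
  rom_rec alpha a (S n) x =
  (alpha - 2 * (a + 1) * x - 2 * INR n * x) * rom_rec alpha a n x
  - rom_lambda a n * rom_sigma x * rom_rec alpha a (pred n) x.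
Proof. reflexivity. Qed.

Lemma rom_lambda0 (a : R) : rom_lambda a 0 = 0.
Proof. unfold rom_lambda; simpl; ring. Qed.

Lemma rom_lambdaS (a : R) (n : nat) :
  rom_lambda a (S n) = rom_lambda a n + 2 * (a + 1 + INR n).
Proof. unfold rom_lambda; rewrite S_INR; ring. Qed.

Lemma is_derive_rom_sigma (x : R) : is_derive rom_sigma x (2 * x).
Proof. unfold rom_sigma; auto_derive; [exact I | ring]. Qed.

Lemma is_derive_rom_w (a alpha x : R) :
  is_derive (rom_w a alpha 0) x
    ((alpha - 2 * (a + 1) * x) / rom_sigma x * rom_w a alpha 0 x).
Proof.
  pose proof (rom_sigma_pos x) as Hs.
  pose proof (is_derive_rom_sigma x) as Ds.
  pose proof (is_derive_rom_acot x) as Dc.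
  unfold rom_w, Rpower.
  auto_derive.
  - repeat split; trivial; [exists (2 * x) | exists (- 1 / rom_sigma x)]; assumption.
  - rewrite (is_derive_unique (fun t : R => rom_sigma t) x _ Ds),
      (is_derive_unique (fun t : R => rom_acot t) x _ Dc).
    simpl; field; lra.
Qed.

(** In the derivative of [Q_(n+1)], the term [2 x] from [sigma'] turns the
    factor [tau - 2 n x] of [Q_(n-1)] into [tau - 2 (n - 1) x], so that the
    recurrence for [Q_n] reassembles with coefficient [- lambda_n]; the derivative
    [- 2 (a + 1 + n)] of [tau - 2 n x] completes it to [- lambda_(n+1)].
    As the recurrence has two earlier terms, the statement for [pred n] is carried
    along. *)
Lemma is_derive_rom_rec (alpha a : R) (n : nat) (x : R) :
  is_derive (rom_rec alpha a n) x (- rom_lambda a n * rom_rec alpha a (pred n) x).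
Proof.
  enough (H : forall x,
    is_derive (rom_rec alpha a n) x (- rom_lambda a n * rom_rec alpha a (pred n) x) /\
    is_derive (rom_rec alpha a (pred n)) x
      (- rom_lambda a (pred n) * rom_rec alpha a (pred (pred n)) x)) by apply H.
  clear x; induction n as [|n IH]; intro x.
  - assert (D : is_derive (rom_rec alpha a 0) x (- rom_lambda a 0 * rom_rec alpha a 0 x)).
    { rewrite rom_lambda0; simpl; auto_derive; [exact I | ring]. }
    split; exact D.
  - destruct (IH x) as [Dn Dp].
    split; [|exact Dn].
    apply is_derive_ext with (1 := fun t => eq_sym (rom_recS alpha a n t)).
    pose proof (is_derive_rom_sigma x) as Ds.
    auto_derive.
    + repeat split; trivial; eexists; eassumption.
    + rewrite (is_derive_unique (fun t : R => rom_sigma t) x _ Ds),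
        (is_derive_unique (fun t : R => rom_rec alpha a n t) x _ Dn),
        (is_derive_unique (fun t : R => rom_rec alpha a (pred n) t) x _ Dp).
      rewrite rom_lambdaS; simpl (pred (S n)).
      destruct n as [|m].
      * rewrite rom_lambda0; simpl; ring.
      * rewrite (rom_recS alpha a m); simpl (pred (S m)).
        rewrite rom_lambdaS, S_INR; ring.
Qed.

Lemma Derive_n_rom_w (alpha a : R) (n : nat) (x : R) :
  Derive_n (rom_w a alpha 0) n x =
  rom_w a alpha 0 x * rom_rec alpha a n x / rom_sigma x ^ n.
Proof.
  revert x; induction n as [|n IH]; intro x.
  - simpl; field.
  - simpl Derive_n; rewrite (Derive_ext _ _ x IH).
    pose proof (rom_sigma_pos x) as Hs.
    pose proof (pow_lt _ n Hs) as Hp.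
    pose proof (is_derive_rom_sigma x) as Ds.
    pose proof (is_derive_rom_w a alpha x) as Dw.
    pose proof (is_derive_rom_rec alpha a n x) as Dq.
    apply is_derive_unique; auto_derive.
    + repeat split; trivial; try lra; eexists; eassumption.
    + rewrite (is_derive_unique (fun t : R => rom_sigma t) x _ Ds),
        (is_derive_unique (fun t : R => rom_w a alpha 0 t) x _ Dw),
        (is_derive_unique (fun t : R => rom_rec alpha a n t) x _ Dq), rom_recS.
      (* [auto_derive] leaves [sigma ^ pred n], to be compared with [sigma ^ n] *)
      destruct n as [|m]; simpl pred; simpl pow in *.
      * rewrite rom_lambda0; simpl; field; lra.
      * pose proof (pow_lt _ m Hs); field; lra.
Qed.

Lemma rom_P_rec (alpha a : R) (n : nat) (x : R) :
  rom_P a alpha n x = rom_rec alpha a n x.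
Proof.
  rewrite rom_PE, Derive_n_rom_w.
  pose proof (rom_w_pos a alpha 0 x).
  pose proof (pow_lt _ n (rom_sigma_pos x)).
  field; lra.
Qed.

Theorem theorem1p3 (alpha a : R) (Q : nat -> R -> R)
    (hQ : rom_complementary alpha a Q) (nu : nat) (x : R) :
  let lambda := INR nu * (2 * a + INR nu + 1) in
  ex_derive (Q nu) x /\
  ex_derive_n (Q nu) 2 x /\
  rom_sigma x * Derive_n (Q nu) 2 x
    + (alpha - Derive rom_sigma x * (a + INR nu)) * Derive (Q nu) x
  = - lambda * Q nu x.
Proof.
  intro lambda; change lambda with (rom_lambda a nu); clear lambda.
  assert (E : forall n t, rom_rec alpha a n t = Q n t).
  { intros n t; rewrite (rom_complementary_unique _ _ _ hQ n t), rom_P_rec; reflexivity. }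
  assert (D1 : forall t, is_derive (Q nu) t
                 (- rom_lambda a nu * rom_rec alpha a (pred nu) t)).
  { intro t; apply is_derive_ext with (1 := E nu), is_derive_rom_rec. }
  assert (D2 : is_derive (Derive (Q nu)) x
                 (- rom_lambda a nu *
                  (- rom_lambda a (pred nu) * rom_rec alpha a (pred (pred nu)) x))).
  { apply is_derive_ext with (fun t => - rom_lambda a nu * rom_rec alpha a (pred nu) t).
    - intro t; symmetry; apply is_derive_unique, D1.
    - apply is_derive_scal, is_derive_rom_rec. }
  split; [|split].
  - eexists; apply D1.
  - eexists; exact D2.
  - change (Derive_n (Q nu) 2 x) with (Derive (Derive (Q nu)) x).
    rewrite (is_derive_unique _ _ _ D2), (is_derive_unique _ _ _ (D1 x)),
      (is_derive_unique _ _ _ (is_derive_rom_sigma x)), <- E.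
    destruct nu as [|m].
    + rewrite rom_lambda0; ring.
    + rewrite rom_recS, S_INR; simpl (pred (S m)); ring.
Qed.
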